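(* Let $d\in\mathbb{N}^*$ and $\mathbf{T}=(T_1,\dots,T_d)\in\mathcal{B}(\mathcal{H})^d$. Then (i) $q\,\sigma_p(\mathbf{T})\subseteq JtW_q(\mathbf{T})$; (ii) $q\,\sigma_{ap}(\mathbf{T})\subseteq \overline{JtW_q(\mathbf{T})}$, where $\overline{JtW_q(\mathbf{T})}$ denotes the closure of $JtW_q(\mathbf{T})$ in $\mathbb{C}^d$.
   Context: $\mathbb{N}^*$ is the set of positive integers. $\mathcal{H}$ is a complex Hilbert space with $\dim\mathcal{H}\ge 2$, $\mathcal{B}(\mathcal{H})$ is the algebra of bounded linear operators on $\mathcal{H}$ with identity $I$, $\mathcal{N}(\cdot)$ denotes the null space, and $q\in\mathbb{C}$ is fixed with $|q|\le 1$. Put $\mathbb{S}_q(\mathcal{H})=\{(x,y)\in\mathcal{H}\times\mathcal{H}: \|x\|=\|y\|=1,\ \langle x,y\rangle=q\}$. The joint $q$-numerical range is $JtW_q(\mathbf{T})=\{(\langle T_1x,y\rangle,\dots,\langle T_dx,y\rangle)\in\mathbb{C}^d : (x,y)\in\mathbb{S}_q(\mathcal{H})\}$. The (joint) point spectrum is $\sigma_p(\mathbf{T})=\{(\xi_1,\dots,\xi_d)\in\mathbb{C}^d : \bigcap_{i=1}^d\mathcal{N}(T_i-\xi_iI)\ne\{0\}\}$, and the (joint) approximate point spectrum is $\sigma_{ap}(\mathbf{T})=\{(\xi_1,\dots,\xi_d)\in\mathbb{C}^d : \inf\{\sum_{i=1}^d\|(T_i-\xi_iI)x\| : x\in\mathcal{H},\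 \|x\|=1\}=0\}$. For a set $E\subseteq\mathbb{C}^d$, $qE=\{q\xi:\xi\in E\}$. *)

(* Defs.v *)
From HB Require Import structures.
From mathcomp Require Import all_boot all_order all_algebra complex.
From mathcomp Require Import all_classical all_reals all_analysis.

Set Implicit Arguments.
Unset Strict Implicit.
Unset Printing Implicit Defensive.

Import Order.TTheory GRing.Theory Num.Theory.
Import numFieldNormedType.Exports.

Local Open Scope classical_set_scope.
Local Open Scope ring_scope.

(* C^d is the type 'rV[R[i]^o]_d: the regular module R[i]^o is how the library
   equips the field R[i] with its topology, and matrices carry the product
   topology of their entries.

   An inner product is {dot H for Num.conj}: a positive definite Hermitian form,
   linear in its FIRST argument and conjugate-linear in the second. *)

Definition hilbert_inner (R : realType) (H : completeNormedModType R[i])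
    (dot : {dot H for @Num.conj R[i]}) : Prop :=
  forall x : H, dot x x = `|x| ^+ 2.

Definition dim_ge2 (R : realType) (H : completeNormedModType R[i]) : Prop :=
  exists u v : H, forall a b : R[i], a *: u + b *: v = 0 -> a = 0 /\ b = 0.

(* The norm of a normed module over R[i] takes its values in R[i]; they are
   nonnegative, hence real, so taking the real part loses nothing. *)
Definition rnorm (R : realType) (H : completeNormedModType R[i]) (x : H) : R :=
  complex.Re `|x|.

Definition bounded_operator (R : realType) (H : completeNormedModType R[i])
    (T : H -> H) : Prop :=
  exists M : R, forall x : H, rnorm (T x) <= M * rnorm x.

Definition null_space (R : realType) (H : completeNormedModType R[i])
    (T : H -> H) : set H :=
  [set x | T x = 0].

Definition Sq (R : realType) (H : completeNormedModType R[i])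
    (dot : {dot H for @Num.conj R[i]}) (q : R[i]) : set (H * H) :=
  [set p | [/\ `|p.1| = 1, `|p.2| = 1 & dot p.1 p.2 = q]].

Definition JtWq (R : realType) (H : completeNormedModType R[i])
    (dot : {dot H for @Num.conj R[i]}) (q : R[i]) (d : nat)
    (T : 'I_d -> {linear H -> H}) : set 'rV[R[i]^o]_d :=
  [set \row_(i < d) dot (T i p.1) p.2 | p in Sq dot q].

Definition point_spectrum (R : realType) (H : completeNormedModType R[i])
    (d : nat) (T : 'I_d -> {linear H -> H}) : set 'rV[R[i]^o]_d :=
  [set xi | \bigcap_(i in [set: 'I_d])
              null_space (fun x => T i x - xi ord0 i *: x) <> [set 0]].

(* inf is the real infimum, a junk value on the empty set: the unit sphere is
   nonempty as soon as H is not reduced to 0. *)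
Definition approx_point_spectrum (R : realType) (H : completeNormedModType R[i])
    (d : nat) (T : 'I_d -> {linear H -> H}) : set 'rV[R[i]^o]_d :=
  [set xi | inf [set \sum_(i < d) rnorm (T i x - xi ord0 i *: x)
                | x in [set x : H | `|x| = 1]] = 0].

Definition scale_set (R : realType) (d : nat) (q : R[i])
    (E : set 'rV[R[i]^o]_d) : set 'rV[R[i]^o]_d :=
  [set q *: xi | xi in E].

(* Main.v *)
Require Import Defs.
From HB Require Import structures.
From mathcomp Require Import all_boot all_order all_algebra complex.
From mathcomp Require Import all_classical all_reals all_analysis.

(** If [x] is a unit vector then, since the space contains a unit vector [z]
    orthogonal to [x], the vector [y = q^* x + sqrt (1 - |q|^2) z] is a unit
    vector with [<x, y> = q] ([exists_unit_vector_dot]).  So every unit vector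
    is the first component of a pair in [Sq dot q], and for such a pair

      [<T_i x, y> - q xi_i = <T_i x - xi_i x, y>],

    whose modulus is at most [|T_i x - xi_i x|] by Cauchy-Schwarz, [y] being a
    unit vector ([JtWq_dist_scale]).  On a common eigenvector the right-hand
    side vanishes, so [q xi] is attained.  When [xi] is an approximate joint
    eigenvalue, a unit vector [x] makes all these norms simultaneously smaller
    than any prescribed radius, which puts a point of the joint q-numerical
    range in every ball around [q xi]. *)

Import Order.TTheory GRing.Theory Num.Theory.
Import numFieldNormedType.Exports.

Local Open Scope classical_set_scope.
Local Open Scope ring_scope.

Section PreHilbert.
Variables (C : numClosedFieldType) (U : lmodType C).
Variable dot : {dot U for @Num.conj C}.

Lemma dot_conjC (u v : U) : dot u v = (dot v u)^*.
Proof. by rewrite hermC /= expr0 mul1r. Qed.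

Lemma dot_sub_proj (u v : U) : dot v v = 1 -> dot (u - dot u v *: v) v = 0.
Proof.
by move=> v1; rewrite linearBl /= linearZl_LR /= v1 mulr1 subrr.
Qed.

(** Pythagoras applied to the decomposition of [u] along [v] and its
    orthogonal complement, which needs no finite dimension. *)
Lemma CauchySchwarz_unit (u v : U) :
  dot v v = 1 -> `|dot u v| ^+ 2 <= dot u u.
Proof.
move=> v1; have uv0 := dot_sub_proj u v v1.
rewrite -{2 3}(subrK (dot u v *: v) u) hnormDd; last first.
  by rewrite linearZr_LR /= uv0 mulr0.
by rewrite [X in _ + X]dnormZ v1 mulr1 lerDr dnorm_ge0.
Qed.

(** Independent [u] and [v] cannot both be multiples of [x], so for one of
    them the component orthogonal to [x] is nonzero and can be normalised. *)
Lemma exists_unit_orthogonal (x u v : U) :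
    (forall a b : C, a *: u + b *: v = 0 -> a = 0 /\ b = 0) ->
    dot x x = 1 ->
  exists z, dot z z = 1 /\ dot x z = 0.
Proof.
move=> uv_free x1.
have [w wx] : exists w, w - dot w x *: x != 0.
  have [eu|] := eqVneq (u - dot u x *: x) 0; last by exists u.
  have [ev|] := eqVneq (v - dot v x *: x) 0; last by exists v.
  move: eu ev => /eqP; rewrite subr_eq0 => /eqP eu /eqP.
  rewrite subr_eq0 => /eqP ev.
  have [] := uv_free (dot v x) (- dot u x).
    rewrite [X in _ *: X + _]eu [X in _ + _ *: X]ev scaleNr !scalerA mulrC subrr //.
  move=> _ /eqP; rewrite oppr_eq0 => /eqP ux0.
  have [] := uv_free 1 0.
    by rewrite scale0r scale1r addr0 eu ux0 scale0r.
  by move=> /eqP; rewrite oner_eq0.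
set p := w - _ in wx.
have px0 : dot p x = 0 by exact: dot_sub_proj.
exists ((sqrtC (dot p p))^-1 *: p); split.
  rewrite dnormZ normfV ger0_norm ?sqrtC_ge0 ?dnorm_ge0 //.
  by rewrite exprVn sqrtCK mulVf // dnorm_eq0.
by rewrite dot_conjC linearZl_LR /= px0 mulr0 rmorph0.
Qed.

(** [dot] is conjugate-linear in its second argument, so the coefficient of
    [y] along [x] is [q^*]; the coefficient along an orthogonal unit vector
    restores [|y| = 1]. *)
Lemma exists_unit_vector_dot (x u v : U) (q : C) :
    (forall a b : C, a *: u + b *: v = 0 -> a = 0 /\ b = 0) ->
    `|q| <= 1 -> dot x x = 1 ->
  exists y, dot y y = 1 /\ dot x y = q.
Proof.
move=> uv_free q1 x1.
have [z [z1 xz0]] := exists_unit_orthogonal x u v uv_free x1.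
have s_ge0 : 0 <= 1 - `|q| ^+ 2 by rewrite subr_ge0 expr_le1.
pose s := sqrtC (1 - `|q| ^+ 2).
have sE : `|s| = s by rewrite ger0_norm // sqrtC_ge0.
exists (q^* *: x + s *: z); split; last first.
  by rewrite linearDr /= !linearZr_LR /= x1 xz0 conjCK mulr1 mulr0 addr0.
rewrite hnormDd; last first.
  by rewrite linearZl_LR linearZr_LR /= xz0 !mulr0.
rewrite [X in X + _]dnormZ [X in _ + X]dnormZ x1 z1 !mulr1 norm_conjC sE.
by rewrite sqrtCK addrC subrK.
Qed.

End PreHilbert.

Section JointNumericalRange.
Variables (R : realType) (H : completeNormedModType R[i]).
Variable dot : {dot H for @Num.conj R[i]}.
Hypotheses (Hdot : hilbert_inner dot) (Hdim : dim_ge2 H).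
Variables (q : R[i]) (Hq : `|q| <= 1) (d : nat) (T : 'I_d -> {linear H -> H}).

Lemma dot_unit (x : H) : `|x| = 1 <-> dot x x = 1.
Proof.
rewrite Hdot; split=> [->|/eqP]; first exact: expr1n.
by rewrite sqrp_eq1 // => /eqP.
Qed.

Lemma rnormE (x : H) : (rnorm x)%:C%C = `|x|.
Proof. by rewrite /rnorm RRe_real // normr_real. Qed.

Lemma rnorm_ge0 (x : H) : 0 <= rnorm x.
Proof. by rewrite -lecR rnormE normr_ge0. Qed.

(** Both inclusions reduce to this estimate: [xi] only enters through the
    residuals [T i x - xi_i x], exact or approximate. *)
Lemma JtWq_dist_scale (x : H) (xi : 'rV[R[i]^o]_d) : `|x| = 1 ->
  exists2 w, JtWq dot q T w &
    forall i, `|w ord0 i - (q *: xi) ord0 i| <= `|T i x - xi ord0 i *: x|.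
Proof.
move=> x1; have [u [v uv_free]] := Hdim.
have [y [y1 xyq]] :=
  exists_unit_vector_dot _ _ dot x u v q uv_free Hq ((dot_unit x).1 x1).
exists (\row_(i < d) dot (T i x) y).
  by exists (x, y) => //; split => //=; apply/dot_unit.
move=> i; rewrite !mxE.
have -> : dot (T i x) y - q * xi ord0 i = dot (T i x - xi ord0 i *: x) y.
  by rewrite linearBl /= linearZl_LR /= xyq mulrC.
rewrite -(@ler_pXn2r _ 2) ?nnegrE ?normr_ge0 // -Hdot.
exact: CauchySchwarz_unit.
Qed.

Lemma scale_point_spectrum_sub_JtWq :
  scale_set q (point_spectrum T) `<=` JtWq dot q T.
Proof.
move=> _ [xi xi_eigen <-].
have [x Tx x0] : exists2 x, (forall i, T i x = xi ord0 i *: x) & x != 0.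
  apply: contrapT => no_eigen; apply: xi_eigen; apply/seteqP; split => x /=.
    move=> xker; apply: contrapT => /eqP x0; apply: no_eigen; exists x => // i.
    by apply/eqP; rewrite -subr_eq0; apply/eqP; exact: xker.
  by move=> -> i _; rewrite /null_space /= linear0 scaler0 subrr.
have [|w Ww wxi] := JtWq_dist_scale (`|x|^-1 *: x) xi.
  by rewrite normrZ normfV normr_id mulVf // normr_eq0.
suff -> : q *: xi = w by [].
apply/rowP => i; apply/esym/eqP; rewrite -subr_eq0 -normr_le0.
apply: le_trans (wxi i) _.
by rewrite linearZ /= Tx !scalerA mulrC subrr normr0.
Qed.

(** The infimum defining the spectrum is a genuine one because the unit sphere
    is nonempty. *)
Lemma approx_point_spectrum_adherent (xi : 'rV[R[i]^o]_d) (e : R) :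
    approx_point_spectrum T xi -> 0 < e ->
  exists2 x : H, `|x| = 1 & forall i, rnorm (T i x - xi ord0 i *: x) < e.
Proof.
rewrite /approx_point_spectrum /=; set S := [set _ | _ in _] => infS e0.
have [u [v uv_free]] := Hdim.
have u0 : u != 0.
  apply/eqP => u0; have [] := uv_free 1 0.
    by rewrite u0 scaler0 scale0r addr0.
  by move=> /eqP; rewrite oner_eq0.
have S_inf : has_inf S.
  split; last first.
    by exists 0 => _ [x _ <-]; apply: sumr_ge0 => i _; exact: rnorm_ge0.
  exists (\sum_(i < d) rnorm (T i (`|u|^-1 *: u) - xi ord0 i *: (`|u|^-1 *: u))).
  by exists (`|u|^-1 *: u) => //=; rewrite normrZ normfV normr_id mulVf // normr_eq0.
have [_ [x x1 <-]] := inf_adherent e0 S_inf.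
rewrite infS add0r => sum_lt; exists x => // i.
apply: le_lt_trans sum_lt; rewrite (bigD1 i) //= lerDl.
by apply: sumr_ge0 => j _; exact: rnorm_ge0.
Qed.

Lemma scale_approx_point_spectrum_sub_closure :
  scale_set q (approx_point_spectrum T) `<=` closure (JtWq dot q T).
Proof.
move=> _ [xi xi_approx <-] B /nbhs_ballP[e /= e0 eB].
(* The radius is a positive element of [R[i]], hence a real number. *)
have eE : (complex.Re e)%:C%C = e by rewrite RRe_real // gtr0_real.
have [|x x1 xe] := approx_point_spectrum_adherent xi (complex.Re e) xi_approx.
  by rewrite -ltcR eE.
have [w Ww wxi] := JtWq_dist_scale x xi x1.
exists w; split=> //; apply: eB; split=> // i j; rewrite (ord1 i).
rewrite -ball_normE /ball_ /= distrC; apply: le_lt_trans (wxi j) _.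
by rewrite -rnormE -eE ltcR.
Qed.

End JointNumericalRange.

Theorem theorem10 (R : realType) (H : completeNormedModType R[i])
    (dot : {dot H for @Num.conj R[i]}) (Hdot : hilbert_inner dot)
    (Hdim : dim_ge2 H) (q : R[i]) (Hq : `|q| <= 1)
    (d : nat) (Hd : (0 < d)%N)
    (T : 'I_d -> {linear H -> H}) (HT : forall i, bounded_operator (T i)) :
  (scale_set q (point_spectrum T) `<=` JtWq dot q T) /\
  (scale_set q (approx_point_spectrum T) `<=` closure (JtWq dot q T)).
Proof.
split; first exact: scale_point_spectrum_sub_JtWq.
exact: scale_approx_point_spectrum_sub_closure.
Qed.
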